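(* Let $\mathbb{K}$ be a field of characteristic zero. For each of the twelve types of painted trees $\widetilde{C/D}$ ($C$ = corollas, plane trees, weakly ordered trees, or weakly ordered forest; $D$ = corollas, plane trees, or weakly ordered trees), the vector space $\mathbb{K}[\widetilde{C/D}]$ with basis $\{F_w : w\in\widetilde{C/D}\}$, graded by the degree of $w$, becomes a graded coassociative coalgebra under the splitting coproduct $$\Delta(F_w)=\sum_{i=0}^{n}F_{w|_{[0,i]}}\otimes F_{w|_{[i,n]}}\qquad (w \text{ with leaves } 0,1,\dots,n).$$
   Context: **Plane trees.** A plane tree is a finite rooted plane tree in which every node has at least two (linearly ordered) inputs; inputs not coming from another node are leaves, and the root has an output edge. The tree with one leaf and no node is allowed. A tree with $n+1$ leaves, numbered $0,\dots,n$ from left to right, has degree $n$. A corolla is a plane tree with at most one node. A node $w$ is strictly above a node $v$ if $v\neq w$ lies on the path from $w$ to the root. A weak order on a set of nodes is a total preorder (an ordered partition of the set into levels), always required to satisfy: if $w$ is strictly above $v$ then the level of $w$ comes strictly after the level of $v$. A weakly ordered tree is a plane tree with a weak order on its nodes. **Painted trees.** A painted tree is a plane tree each of whose nodes is declared painted, half-painted or unpainted, such that if $w$ is strictly above $v$ and $v$ is half-painted or unpainted, then $w$ is unpainted. (Thus an unpainted forest is grafted onto a painted base tree; the paint line meets each leaf-to-root path once, in the middle of an edge or at a half-painted node. There is one painted tree with one leaf.) Two non-painted nodes lie over the same base leaf if the path joining them in the tree meets no painted node. A painted tree of type $\widetilde{C/D}$ is a painted tree with the following additional data or conditions. Base: $D$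 = corollas: at most one painted node. $D$ = plane trees: no condition. $D$ = weakly ordered trees: a weak order on the set of painted nodes is given. Forest: $C$ = corollas: no unpainted node is strictly above another unpainted node. $C$ = plane trees: no condition. $C$ = weakly ordered trees: for each base leaf, a weak order on the unpainted nodes over that base leaf is given. $C$ = weakly ordered forest: a weak order on the set of all unpainted nodes is given. **Splitting.** For a (painted) tree $w$ with leaves $0,\dots,n$ and $0\le i\le j\le n$, $w|_{[i,j]}$ is the tree spanned by the root and the leaves $i,\dots,j$: remove all other leaves and everything not on a path from leaves $i,\dots,j$ to the root, and suppress nodes left with a single input; the remaining nodes keep their colors, and weak orders are restricted. The result has the same type as $w$. Splitting $w$ leaf-to-root at leaf $i$ yields the pair $(w|_{[0,i]},w|_{[i,n]})$. The counit is the coefficient of the one-leaf painted tree. *)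

(* Defs.v *)
From HB Require Import structures.
From mathcomp Require Import all_boot ssralg.
From mathcomp Require Export finmap.
From mathcomp.multinomials Require Export monalg.

Set Implicit Arguments.
Unset Strict Implicit.
Unset Printing Implicit Defensive.

Import GRing.Theory.

Section LinearExtension.
Local Open Scope ring_scope.
Context (K : fieldType) (T : choiceType) (V : lmodType K).
Implicit Types (f : T -> V) (u : {malg K[T]}).

(* The linear map {malg K[T]} -> V sending the basis vector << x >> to f x. *)
Definition lin_ext f u : V := \sum_(x <- msupp u) u@_x *: f x.

Lemma lin_extEw f u (d : {fset T}) : (msupp u `<=` d)%fset ->
  lin_ext f u = \sum_(x <- d) u@_x *: f x.
Proof.
move=> sud; rewrite /lin_ext; apply/big_fset_incl => // x _.
by rewrite -mcoeff_eq0 => /eqP ->; rewrite scale0r.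
Qed.

Lemma lin_ext_basis f x : lin_ext f << x >> = f x.
Proof.
rewrite (@lin_extEw _ _ [fset x]%fset) ?msuppU_le //.
by rewrite big_seq_fset1 mcoeffUU scale1r.
Qed.

Lemma lin_ext_is_linear f : linear (lin_ext f).
Proof.
move=> a u v.
pose d := (msupp u `|` msupp v `|` msupp (a *: u + v))%fset.
rewrite !(@lin_extEw _ _ d) /d.
- rewrite scaler_sumr -big_split /=; apply: eq_bigr => x _.
  by rewrite mcoeffD mcoeffZ scalerDl scalerA.
- by rewrite -fsetUA fsetUCA fsubsetUl.
- by rewrite -fsetUA fsubsetUl.
- by rewrite fsubsetUr.
Qed.

HB.instance Definition _ f :=
  GRing.isLinear.Build K {malg K[T]} V *:%R (lin_ext f) (lin_ext_is_linear f).

Lemma lin_ext_unique (g : {linear {malg K[T]} -> V}) u :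
  g u = lin_ext (fun x => g << x >>) u.
Proof.
rewrite [in LHS](monalgE u) linear_sum /=; apply: eq_bigr => x _.
by rewrite -linearZ /=; congr (g _); apply/malgP => y;
   rewrite mcoeffZ !mcoeffU mulrnAr mulr1.
Qed.

Lemma eq_lin_ext f1 f2 u : f1 =1 f2 -> lin_ext f1 u = lin_ext f2 u.
Proof. by move=> ef; apply: eq_bigr => x _; rewrite ef. Qed.

End LinearExtension.

Lemma lin_ext_comp (K : fieldType) (T : choiceType) (V W : lmodType K)
    (g : {linear V -> W}) (f : T -> V) (u : {malg K[T]}) :
  g (lin_ext f u) = lin_ext (g \o f) u.
Proof.
by rewrite linear_sum; apply: eq_bigr => x _; rewrite linearZ.
Qed.

(* The tensor product of {malg K[S]} and {malg K[T]} is realised as the vector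
   space {malg K[S * T]}, with << x >> (x) << y >> = << (x, y) >>: see
   tens_basis, tens_linearl, tens_linearr and tens_universal. *)

Section Tensor.
Local Open Scope ring_scope.
Context (K : fieldType) (S T : choiceType).

Definition tens (u : {malg K[S]}) (v : {malg K[T]}) : {malg K[(S * T)%type]} :=
  lin_ext (fun x => lin_ext (fun y => << (x, y) >>) v) u.

Lemma tens_basis x y : tens << x >> << y >> = << (x, y) >>.
Proof. by rewrite /tens !lin_ext_basis. Qed.

Lemma tens_linearl v : linear (tens ^~ v).
Proof. exact: lin_ext_is_linear. Qed.

Lemma tens_linearr u : linear (tens u).
Proof.
move=> a v w; rewrite /tens /lin_ext scaler_sumr -big_split /=.
apply: eq_bigr => x _; rewrite [X in _ *: X]lin_ext_is_linear scalerDr.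
by rewrite !scalerA mulrC.
Qed.

Lemma tens_universal (V : lmodType K) (b : {malg K[S]} -> {malg K[T]} -> V) :
    (forall v, linear (b ^~ v)) -> (forall u, linear (b u)) ->
  exists2 h : {linear {malg K[(S * T)%type]} -> V},
    forall u v, h (tens u v) = b u v
  & forall h' : {linear {malg K[(S * T)%type]} -> V},
      (forall u v, h' (tens u v) = b u v) -> h' =1 h.
Proof.
move=> bl br; exists (lin_ext (fun p => b << p.1 >> << p.2 >>)) => [u v|h' h'E w].
  pose bL := GRing.isLinear.Build K {malg K[S]} V *:%R (b ^~ v) (bl v).
  pose bv : {linear {malg K[S]} -> V} := HB.pack (b ^~ v) bL.
  rewrite (lin_ext_unique bv u : b u v = _) lin_ext_comp.
  apply: eq_lin_ext => x; rewrite /comp lin_ext_comp.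
  pose bR := GRing.isLinear.Build K {malg K[T]} V *:%R (b << x >>) (br _).
  pose bx : {linear {malg K[T]} -> V} := HB.pack (b << x >>) bR.
  rewrite [RHS](lin_ext_unique bx v : b << x >> v = _).
  by apply: eq_lin_ext => y; rewrite /= lin_ext_basis.
by rewrite (lin_ext_unique h'); apply: eq_lin_ext => -[x y]; rewrite -tens_basis h'E.
Qed.

End Tensor.

Section TensorMaps.
Local Open Scope ring_scope.
Context (K : fieldType) (R S T U : choiceType).

(* f (x) g, for linear f and g *)
Definition tens_map (f : {malg K[R]} -> {malg K[S]})
    (g : {malg K[T]} -> {malg K[U]}) :
    {malg K[(R * T)%type]} -> {malg K[(S * U)%type]} :=
  lin_ext (fun p => tens (f << p.1 >>) (g << p.2 >>)).

(* The canonical isomorphism from (A (x) B) (x) C to A (x) (B (x) C). *)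
Definition tens_assoc :
    {malg K[(R * S * T)%type]} -> {malg K[(R * (S * T))%type]} :=
  lin_ext (fun p => << (p.1.1, (p.1.2, p.2)) >>).

(* e (x) id and id (x) e, for a linear form e, composed with the canonical
   isomorphisms from K (x) V and V (x) K to V. *)
Definition form_tensl (e : {malg K[R]} -> K) :
    {malg K[(R * S)%type]} -> {malg K[S]} :=
  lin_ext (fun p => e << p.1 >> *: << p.2 >>).

Definition form_tensr (e : {malg K[S]} -> K) :
    {malg K[(R * S)%type]} -> {malg K[R]} :=
  lin_ext (fun p => e << p.2 >> *: << p.1 >>).

End TensorMaps.

Section GradedCoalgebra.
Local Open Scope ring_scope.
Context (K : fieldType).

(* The degree d component of {malg K[T]} is spanned by the << x >> with
   deg x = d. *)
Definition homogeneous (T : choiceType) (deg : T -> nat) (d : nat)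
    (u : {malg K[T]}) : Prop :=
  forall x, x \in msupp u -> deg x = d.

Record graded_coalgebra (T : choiceType) (deg : T -> nat)
    (Delta : {malg K[T]} -> {malg K[(T * T)%type]})
    (eps : {malg K[T]} -> K) : Prop := GradedCoalgebra {
  coproduct_linear : linear Delta;
  counit_linear : scalar eps;
  coproduct_assoc : forall u,
    tens_assoc (tens_map Delta id (Delta u)) = tens_map id Delta (Delta u);
  coproduct_counitl : forall u, form_tensl eps (Delta u) = u;
  coproduct_counitr : forall u, form_tensr eps (Delta u) = u;
  coproduct_graded : forall d u, homogeneous deg d u ->
    homogeneous (fun p : T * T => (deg p.1 + deg p.2)%N) d (Delta u);
  counit_graded : forall d u, homogeneous deg d u -> d != 0%N -> eps u = 0
}.

End GradedCoalgebra.

Variant color := Painted | Half | Unpainted.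

Definition nat_of_color c : nat :=
  match c with Painted => 0 | Half => 1 | Unpainted => 2 end.

Definition color_of_nat n : color :=
  match n with 0 => Painted | 1 => Half | _ => Unpainted end.

Lemma nat_of_colorK : cancel nat_of_color color_of_nat.
Proof. by case. Qed.

HB.instance Definition _ := Countable.copy color (can_type nat_of_colorK).

(* The label (c, l) of a node consists of its color c and its level l in a
   weak order; l is always 0 when the node takes part in no weak order. *)
Definition label := (color * nat)%type.

Inductive tree := Leaf | Node of label & seq tree.

Definition tree_nested_ind (P : tree -> Prop) (PL : P Leaf)
    (PN : forall a ts, (forall k, k < size ts -> P (nth Leaf ts k)) ->
      P (Node a ts)) : forall t, P t :=
  fix ind t := match t return P t with
  | Leaf => PL
  | Node a ts => PN a ts
      ((fix inds ts : forall k, k < size ts -> P (nth Leaf ts k) :=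
        match ts return forall k, k < size ts -> P (nth Leaf ts k) with
        | [::] => fun k klt => False_ind _ (elimF idP (ltn0 k) klt)
        | u :: us => fun k =>
            match k return k < size (u :: us) -> P (nth Leaf (u :: us) k) with
            | 0 => fun _ => ind u
            | k'.+1 => fun klt => inds us k' klt
            end
        end) ts)
  end.

Fixpoint gentree_of_tree (t : tree) : GenTree.tree label :=
  if t is Node a ts then
    GenTree.Node 1 (GenTree.Leaf a :: map gentree_of_tree ts)
  else GenTree.Node 0 [::].

Fixpoint tree_of_gentree (g : GenTree.tree label) : tree :=
  if g is GenTree.Node _ (GenTree.Leaf a :: gs) then
    Node a (map tree_of_gentree gs)
  else Leaf.

Lemma gentree_of_treeK : cancel gentree_of_tree tree_of_gentree.
Proof.
elim/tree_nested_ind => //= a ts IH; congr Node.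
rewrite -map_comp; apply: (@eq_from_nth _ Leaf); rewrite size_map // => k klt.
by rewrite (nth_map Leaf) //= IH.
Qed.

HB.instance Definition _ := Countable.copy tree (can_type gentree_of_treeK).

Lemma tree_ind' (P : tree -> Prop) :
  P Leaf -> (forall a ts, (forall t, t \in ts -> P t) -> P (Node a ts)) ->
  forall t, P t.
Proof.
move=> PL PN; elim/tree_nested_ind => // a ts IH; apply: PN => t.
by case/(nthP Leaf) => k klt <-; apply: IH.
Qed.

Fixpoint nleaves (t : tree) : nat :=
  if t is Node _ ts then sumn (map nleaves ts) else 1.

Definition degree (t : tree) : nat := (nleaves t).-1.

Fixpoint labels (t : tree) : seq label :=
  if t is Node a ts then a :: flatten (map labels ts) else [::].

Fixpoint tmap (f : label -> label) (t : tree) : tree :=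
  if t is Node a ts then Node (f a) (map (tmap f) ts) else Leaf.

Fixpoint plane (t : tree) : bool :=
  if t is Node _ ts then (1 < size ts) && all plane ts else true.

(* r a b holds whenever the node labelled b is strictly above the one
   labelled a. *)
Fixpoint above (r : rel label) (t : tree) : bool :=
  if t is Node a ts then
    all (r a) (flatten (map labels ts)) && all (above r) ts
  else true.

Definition has_color (c : color) (a : label) : bool := a.1 == c.

Definition painted (t : tree) : bool :=
  above (fun a b => has_color Painted a || has_color Unpainted b) t.

(* A weak order on the nodes of color c is an ordered partition of these nodes
   into levels, which are numbered 0, 1, ..., with no level empty. *)

Definition levels (c : color) (t : tree) : seq nat :=
  [seq a.2 | a <- labels t & has_color c a].

Definition initial_segment (s : seq nat) : bool :=
  all (fun l => all (mem s) (iota 0 l)) s.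

Definition lt_level (c : color) : rel label :=
  fun a b => has_color c a && has_color c b ==> (a.2 < b.2).

Definition weakly_ordered (c : color) (t : tree) : bool :=
  initial_segment (levels c t) && above (lt_level c) t.

(* Discarding the levels that have become empty: the levels of the set s are
   renumbered increasingly as 0, 1, .... *)
Definition rank (s : seq nat) (l : nat) : nat :=
  count (fun m => m < l) (undup s).

Definition renumber (c : color) (t : tree) : tree :=
  tmap (fun a => if has_color c a then (a.1, rank (levels c t) a.2) else a) t.

(* The trees grafted onto the leaves of the base tree, the half-painted nodes
   being roots of such trees. *)
Fixpoint base_leaves (t : tree) : seq tree :=
  match t with
  | Node (Painted, _) ts => flatten (map base_leaves ts)
  | _ => [:: t]
  end.

Fixpoint renumber_base_leaves (t : tree) : tree :=
  match t with
  | Node ((Painted, _) as a) ts => Node a (map renumber_base_leaves ts)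
  | _ => renumber Unpainted t
  end.

Variant forest_type :=
  | ForestCorollas | ForestPlane | ForestWeakTrees | WeakForest.

Variant base_type := BaseCorollas | BasePlane | BaseWeakTrees.

Definition base_ok (D : base_type) (t : tree) : bool :=
  match D with
  | BaseCorollas => count (has_color Painted) (labels t) <= 1
  | BasePlane => true
  | BaseWeakTrees => weakly_ordered Painted t
  end.

Definition forest_ok (C : forest_type) (t : tree) : bool :=
  match C with
  | ForestCorollas =>
      above (fun a b => ~~ (has_color Unpainted a && has_color Unpainted b)) t
  | ForestPlane => true
  | ForestWeakTrees => all (weakly_ordered Unpainted) (base_leaves t)
  | WeakForest => weakly_ordered Unpainted t
  end.

Definition has_level (C : forest_type) (D : base_type) (c : color) : bool :=
  match c with
  | Painted => if D is BaseWeakTrees then true else false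
  | Half => false
  | Unpainted =>
      match C with ForestWeakTrees | WeakForest => true | _ => false end
  end.

Definition is_painted_tree (C : forest_type) (D : base_type) (t : tree) : bool :=
  [&& plane t, painted t,
      all (fun a => has_level C D a.1 || (a.2 == 0)) (labels t),
      base_ok D t & forest_ok C t].

Record painted_tree (C : forest_type) (D : base_type) := PaintedTree {
  tree_of :> tree;
  _ : is_painted_tree C D tree_of
}.

HB.instance Definition _ C D := [isSub for @tree_of C D].
HB.instance Definition _ C D := [Countable of painted_tree C D by <:].

Lemma one_leaf_subproof C D : is_painted_tree C D Leaf.
Proof. by case: C; case: D. Qed.

Definition one_leaf C D : painted_tree C D :=
  PaintedTree (one_leaf_subproof C D).

(* The tree spanned by the root and the leaves satisfying keep, leaves being
   numbered from 0; None if there is no such leaf. *)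
Fixpoint span (keep : pred nat) (t : tree) : option tree :=
  match t with
  | Leaf => if keep 0 then Some Leaf else None
  | Node a ts =>
      let fix spans (keep : pred nat) (ts : seq tree) : seq (option tree) :=
        if ts is t :: ts' then
          span keep t :: spans (fun k => keep (nleaves t + k)) ts'
        else [::] in
      match pmap id (spans keep ts) with
      | [::] => None
      | [:: u] => Some u
      | us => Some (Node a us)
      end
  end.

Definition restrict_orders (C : forest_type) (D : base_type) (t : tree) : tree :=
  let t' := if D is BaseWeakTrees then renumber Painted t else t in
  match C with
  | ForestWeakTrees => renumber_base_leaves t'
  | WeakForest => renumber Unpainted t'
  | _ => t'
  end.

(* w|_[i,j]; this is the one-leaf tree if there is no leaf in [i,j]. *)
Definition restrict_tree (C : forest_type) (D : base_type) (i j : nat)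
    (t : tree) : tree :=
  restrict_orders C D (odflt Leaf (span (fun k => i <= k <= j) t)).

Fixpoint spans (keep : pred nat) (ts : seq tree) : seq (option tree) :=
  if ts is t :: ts' then
    span keep t :: spans (fun k => keep (nleaves t + k)) ts'
  else [::].

Lemma spanE keep a ts :
  span keep (Node a ts) =
    match pmap id (spans keep ts) with
    | [::] => None
    | [:: u] => Some u
    | us => Some (Node a us)
    end.
Proof. by []. Qed.

Lemma span_sub keep t u : span keep t = Some u ->
  [/\ plane t -> plane u, subseq (labels u) (labels t)
    & forall r, above r t -> above r u].
Proof.
elim/tree_ind': t keep u => [|a ts IH] keep u; first by move=> /=; case: ifP => // _ [<-].
rewrite spanE; set us := pmap _ _.
have [pus sus aus]: [/\ all plane ts -> all plane us,
    subseq (flatten (map labels us)) (flatten (map labels ts))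
    & forall r, all (above r) ts -> all (above r) us].
  rewrite {}/us; elim: ts keep IH => [|t ts IHts] keep IH; first by [].
  have [|pus sus aus] := IHts (fun k => keep (nleaves t + k)).
    by move=> v vts; apply: IH; rewrite inE vts orbT.
  have := IH t (mem_head _ _) keep; rewrite /=.
  case: (span keep t) => [v|] /=; last first.
    move=> _; split=> [/andP[_ /pus]||r /andP[_ /aus]] //.
    by apply: subseq_trans sus _; apply: suffix_subseq.
  case/(_ v) => // pv sv av; split.
  - by case/andP=> /pv -> /pus ->.
  - exact: cat_subseq.
  - by move=> r /andP[/av -> /aus ->].
case: us pus sus aus => [|v [|w us]] // pus sus aus [<-].
  split=> /=.
  - by case/andP=> _ /pus/andP[].
  - by rewrite /= cats0 in sus; apply: subseq_trans sus (subseq_cons _ _).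
  - by move=> r /andP[_ /aus/andP[]].
split.
- by case/andP=> _ /pus.
- by apply: (@cat_subseq _ [:: a] _ [:: a]).
- move=> r /andP[ra /aus ats]; apply/andP; split=> //.
  by apply/allP => b /(mem_subseq sus); move/allP: ra; apply.
Qed.

Lemma labels_tmap f t : labels (tmap f t) = map f (labels t).
Proof.
elim/tree_ind': t => //= a ts IH; congr cons; rewrite map_flatten -!map_comp.
by congr flatten; apply/eq_in_map => t /IH.
Qed.

Lemma plane_tmap f t : plane (tmap f t) = plane t.
Proof.
elim/tree_ind': t => //= a ts IH; rewrite size_map all_map; congr andb.
by apply: eq_in_all => t /IH.
Qed.

Lemma above_tmap r f t :
  above r (tmap f t) = above (fun a b => r (f a) (f b)) t.
Proof.
elim/tree_ind': t => //= a ts IH; congr andb; last first.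
  by rewrite all_map; apply: eq_in_all => t /IH.
rewrite -map_comp (eq_map (labels_tmap f)).
by rewrite (map_comp (map f)) -map_flatten all_map.
Qed.

Lemma sub_above (r r' : rel label) t : {in labels t &, forall a b, r a b -> r' a b} ->
  above r t -> above r' t.
Proof.
elim/tree_ind': t => //= a ts IH rr' /andP[/allP ra /allP rts].
apply/andP; split; apply/allP=> t tts.
  by apply: rr'; rewrite ?mem_head ?inE ?tts ?orbT //; apply: ra.
apply: IH => //; last exact: rts.
move=> b c bt ct; apply: rr'; rewrite inE; apply/orP; right.
  by apply/flatten_mapP; exists t.
by apply/flatten_mapP; exists t.
Qed.

Lemma eq_above (r r' : rel label) t : r =2 r' -> above r t = above r' t.
Proof. by move=> e; apply/idP/idP; apply: sub_above => a b _ _; rewrite e. Qed.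


Lemma ltn_rank s x y : x \in s -> x < y -> rank s x < rank s y.
Proof.
move=> xs xy; rewrite /rank.
have -> : count (fun m => m < y) (undup s) =
    count (fun m => m < x) (undup s) + count (fun m => x <= m < y) (undup s).
  rewrite -count_predUI -[LHS]addn0; congr addn.
    by apply: eq_count => m /=; case: (ltnP m x) => //= /ltn_trans -> .
  by rewrite -(count_pred0 (undup s)); apply: eq_count => m /=; case: ltnP.
rewrite -[X in X < _]addn0 ltn_add2l -has_count; apply/hasP.
by exists x; rewrite ?mem_undup //= leqnn.
Qed.

Lemma count_ltn_nth s i : sorted ltn s -> i < size s ->
  count (fun m => m < nth 0 s i) s = i.
Proof.
elim: s i => //= x s IH [|i] xs /=.
  move=> _; rewrite ltnn add0n; apply/eqP; rewrite -leqn0 leqNgt -has_count.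
  apply/hasPn => y ys; rewrite -leqNgt ltnW //.
  by have /allP-> := order_path_min ltn_trans xs.
rewrite ltnS => ilt; rewrite IH ?(path_sorted xs) //.
by have /allP-> := order_path_min ltn_trans xs; rewrite ?mem_nth.
Qed.

Lemma initial_segment_rank s : initial_segment (map (rank s) s).
Proof.
apply/allP=> _ /mapP[x xs ->]; apply/allP=> m; rewrite mem_iota add0n /= => mx.
pose s' := sort leq (undup s).
have ss' : sorted ltn s'.
  by rewrite ltn_sorted_uniq_leq sort_uniq undup_uniq sort_sorted //; apply: leq_total.
have rs' l : rank s l = count (fun m => m < l) s'.
  by apply/permP; rewrite perm_sym perm_sort.
have ms' : m < size s' by rewrite rs' in mx; apply: leq_trans mx (count_size _ _).
apply/mapP; exists (nth 0 s' m); first by rewrite -mem_undup -(mem_sort leq) mem_nth.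
by rewrite rs' count_ltn_nth.
Qed.

Lemma weakly_ordered_renumber c t :
  above (lt_level c) t -> weakly_ordered c (renumber c t).
Proof.
move=> ct; apply/andP; split.
  have -> : levels c (renumber c t) = map (rank (levels c t)) (levels c t).
    rewrite /levels /renumber labels_tmap; move: (rank _) => f.
    rewrite filter_map -!map_comp /has_color.
    rewrite (@eq_filter _ _ (has_color c)) => [|a]; last by rewrite /= /has_color; case: ifP.
    by apply/eq_in_map => a; rewrite mem_filter /has_color /= => /andP[-> _].
  exact: initial_segment_rank.
rewrite above_tmap; apply: sub_above ct => a b at_ _.
rewrite /lt_level; case ca: (has_color c a); case cb: (has_color c b) => //=.
- move=> ab; apply/implyP => _; apply: ltn_rank ab.
  by apply/mapP; exists a; rewrite // mem_filter ca.
- by rewrite /has_color /= in ca cb *; rewrite ca cb.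
- by rewrite ca.
- by rewrite ca.
Qed.

(* Erases the levels of all nodes but those of color c. *)
Definition forget c : tree -> tree :=
  tmap (fun a => if has_color c a then a else (a.1, 0)).

Lemma has_color_forget c d a :
  has_color d (if has_color c a then a else (a.1, 0)) = has_color d a.
Proof. by case: ifP. Qed.

Lemma plane_forget c t : plane (forget c t) = plane t.
Proof. exact: plane_tmap. Qed.

Lemma painted_forget c t : painted (forget c t) = painted t.
Proof.
by rewrite /painted above_tmap; apply: eq_above => a b; rewrite !has_color_forget.
Qed.

Lemma corollas_forget c d t :
  above (fun a b => ~~ (has_color d a && has_color d b)) (forget c t) =
  above (fun a b => ~~ (has_color d a && has_color d b)) t.
Proof. by rewrite above_tmap; apply: eq_above => a b; rewrite !has_color_forget. Qed.

Lemma count_forget c d t :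
  count (has_color d) (labels (forget c t)) = count (has_color d) (labels t).
Proof.
by rewrite labels_tmap count_map; apply: eq_count => a /=; rewrite has_color_forget.
Qed.

Lemma above_lt_forget c t :
  above (lt_level c) (forget c t) = above (lt_level c) t.
Proof.
rewrite above_tmap; apply: eq_above => a b; rewrite /lt_level !has_color_forget.
by case ca: (has_color c a); case cb: (has_color c b).
Qed.

Lemma weakly_ordered_forget c t :
  weakly_ordered c (forget c t) = weakly_ordered c t.
Proof.
congr andb; last exact: above_lt_forget.
congr initial_segment; rewrite /levels labels_tmap filter_map -map_comp.
rewrite (@eq_filter _ _ (has_color c)) => [|a]; last by rewrite /= has_color_forget.
by apply/eq_in_map => a; rewrite mem_filter /= => /andP[-> _].
Qed.

Lemma zero_forget c t :
  all (fun a => has_color c a ==> (a.2 == 0)) (labels (forget c t)) =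
  all (fun a => has_color c a ==> (a.2 == 0)) (labels t).
Proof.
rewrite labels_tmap all_map; apply: eq_all => a /=; rewrite has_color_forget.
by case: (has_color c a).
Qed.

Lemma tmap_comp f g t : tmap f (tmap g t) = tmap (f \o g) t.
Proof.
elim/tree_ind': t => //= a ts IH; congr Node; rewrite -map_comp.
by apply/eq_in_map => t /IH.
Qed.

Lemma eq_tmap f g t : f =1 g -> tmap f t = tmap g t.
Proof.
by move=> fg; elim/tree_ind': t => //= a ts IH; rewrite fg; congr Node; apply/eq_in_map.
Qed.

Lemma forget_renumber c d t : c != d -> forget c (renumber d t) = forget c t.
Proof.
move=> cd; rewrite /forget tmap_comp; apply: eq_tmap => a /=.
case da: (has_color d a) => //.
have /negPf ca : ~~ has_color c a by rewrite /has_color (eqP da) eq_sym.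
by rewrite /= ca; rewrite /has_color /= in ca *; rewrite ca.
Qed.

Lemma forget_renumber_base_leaves c t : c != Unpainted ->
  forget c (renumber_base_leaves t) = forget c t.
Proof.
move=> cU; elim/tree_ind': t => // -[[] l] ts IH; try exact: forget_renumber.
by congr Node; rewrite -map_comp; apply/eq_in_map => t /IH.
Qed.

Lemma base_leaves_renumber t :
  base_leaves (renumber_base_leaves t) = map (renumber Unpainted) (base_leaves t).
Proof.
elim/tree_ind': t => // -[[] l] ts IH //=.
rewrite map_flatten -!map_comp; congr flatten; apply/eq_in_map => t /IH //.
Qed.

Lemma above_base_leaves t :
  all (above (lt_level Unpainted)) (base_leaves t) =
  above (lt_level Unpainted) t.
Proof.
elim/tree_ind': t => // -[[] l] ts IH; try by rewrite /= andbT.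
rewrite [RHS](_ : _ = all (above (lt_level Unpainted)) ts); last first.
  by rewrite /= [X in X && _](_ : _ = true) //; apply/allP.
rewrite [LHS]/=.
transitivity (all (fun t => all (above (lt_level Unpainted)) (base_leaves t)) ts).
  by elim: ts {IH} => //= t ts; rewrite all_cat => ->.
by apply: eq_in_all => t /IH.
Qed.

Lemma restrict_tree_subproof C D i j t :
  is_painted_tree C D t -> is_painted_tree C D (restrict_tree C D i j t).
Proof.
rewrite /restrict_tree; case su: (span _ t) => [u|] /=; last first.
  by case: C; case: D.
have [plu subu abu] := span_sub su => {su}.
case/and5P => /plu {}plu /abu pau /allP zt bt ft.
have zu c : ~~ has_level C D c ->
    all (fun a => has_color c a ==> (a.2 == 0)) (labels u).
  move=> nc; apply/allP => a /(mem_subseq subu)/zt.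
  by apply: contraTT; rewrite negb_imply => /andP[/eqP->] /negPf->; rewrite (negPf nc).
have bu : if D is BaseWeakTrees then above (lt_level Painted) u else base_ok D u.
  case: D bt {zt zu} => //= [|/andP[_ /abu]//].
  by apply: leq_trans; apply: leq_count_subseq.
have fu : match C with
    | ForestWeakTrees | WeakForest => above (lt_level Unpainted) u
    | _ => forest_ok C u end.
  case: C ft {zt zu} => //= [/abu//||/andP[_ /abu]//].
  move=> ft; apply: abu; rewrite -above_base_leaves.
  by apply: sub_all ft => v /andP[].
rewrite /is_painted_tree; set v := restrict_orders C D u.
pose u' := if D is BaseWeakTrees then renumber Painted u else u.
have Uu' : forget Unpainted u' = forget Unpainted u.
  by rewrite /u'; case: (D) => //; apply: forget_renumber.
have vu' c : c != Unpainted -> forget c v = forget c u'.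
  rewrite /v /restrict_orders -/u'.
  by case: (C) => // cU; rewrite ?forget_renumber_base_leaves ?forget_renumber.
have Hvu : forget Half v = forget Half u.
  by rewrite vu' // /u'; case: (D) => //; apply: forget_renumber.
have Puv : if D is BaseWeakTrees then true else forget Painted v == forget Painted u.
  by rewrite vu' // /u'; case: (D).
have Uuv : match C with ForestWeakTrees | WeakForest => true
    | _ => forget Unpainted v == forget Unpainted u end.
  by rewrite /v /restrict_orders -/u' -Uu'; case: (C).
apply/and5P; split.
- by rewrite -(plane_forget Half) Hvu plane_forget.
- by rewrite -(painted_forget Half) Hvu painted_forget.
- have zv c : ~~ has_level C D c ->
      all (fun a => has_color c a ==> (a.2 == 0)) (labels v).
    move=> nc; rewrite -(zero_forget c); suff -> : forget c v = forget c u.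
      by rewrite zero_forget zu.
    case: c nc => /=.
    - by case: (D) Puv => //= /eqP.
    - by [].
    - by case: (C) Uuv => //= /eqP.
  apply/allP => a av; case nc: (has_level C D a.1) => //=.
  by have /allP/(_ a av) := zv _ (negbT nc); rewrite /has_color eqxx.
- case eD: (D) bu => //= [|] bu.
    by rewrite -(count_forget Half) Hvu count_forget.
  rewrite -(weakly_ordered_forget Painted) vu' // weakly_ordered_forget /u' eD.
  exact: weakly_ordered_renumber.
have {}fu : match C with
    | ForestWeakTrees | WeakForest => above (lt_level Unpainted) u'
    | _ => forest_ok C u end.
  by rewrite -(above_lt_forget _ u') Uu' above_lt_forget.
rewrite /v /restrict_orders -/u'.
case: (C) fu => //= fu.
- by rewrite -(corollas_forget Unpainted) Uu' corollas_forget.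
- rewrite base_leaves_renumber all_map; move: fu; rewrite -above_base_leaves.
  by apply: sub_all => w; apply: weakly_ordered_renumber.
- exact: weakly_ordered_renumber.
Qed.

Definition restrict C D (w : painted_tree C D) (i j : nat) : painted_tree C D :=
  PaintedTree (restrict_tree_subproof i j (valP w)).

(* Main.v *)
Require Import Defs.
From mathcomp Require Import all_boot ssralg zify.

Import GRing.Theory.

(** Restricting w to the leaves a, ..., b and then to the leaves c, ..., d of
    the result amounts to restricting w to the leaves a + c, ..., a + d.  For
    the underlying trees this is transitivity of span; renumbering the levels
    in between is harmless, because it is a strictly monotone relabelling and
    the final renumbering only depends on the relative order of the levels.
    Both iterated coproducts of F_w are therefore the sum, over k <= i, of the
    tensors of the restrictions of w to [0, k], [k, i] and [i, n]. *)

(** * Leaf counts and relabelled trees *)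

Lemma plane_nleaves_gt0 t : plane t -> 0 < nleaves t.
Proof.
elim/tree_ind': t => // a [|t ts] IH //= /andP[_ /andP[pt _]].
by rewrite addn_gt0 IH ?mem_head.
Qed.

Lemma plane_nleaves1 t : plane t -> nleaves t = 1 -> t = Leaf.
Proof.
case: t => // a [|t [|u ts]] //= /and3P[/plane_nleaves_gt0 t0 /plane_nleaves_gt0 u0 _].
lia.
Qed.

Lemma nleaves_tmap f t : nleaves (tmap f t) = nleaves t.
Proof.
elim/tree_ind': t => //= a ts IH; rewrite -map_comp; congr sumn.
by apply/eq_in_map => t /IH.
Qed.

Lemma eq_in_tmap f g t : {in labels t, f =1 g} -> tmap f t = tmap g t.
Proof.
elim/tree_ind': t => //= a ts IH fg; rewrite fg ?mem_head //; congr Node.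
apply/eq_in_map => t tts; apply: IH => // b bt; apply: fg; rewrite inE.
by apply/orP; right; apply/flatten_mapP; exists t.
Qed.

Lemma tmap_in_id f t : {in labels t, f =1 id} -> tmap f t = t.
Proof.
elim/tree_ind': t => //= a ts IH fg; rewrite fg ?mem_head //; congr Node.
rewrite -[RHS]map_id.
apply/eq_in_map => t tts; apply: IH => // b bt; apply: fg; rewrite inE.
by apply/orP; right; apply/flatten_mapP; exists t.
Qed.

(** * Spanned subtrees: leaf numbering and transitivity *)

Lemma count_iotaD (keep : pred nat) m n :
  count keep (iota 0 (m + n)) =
  count keep (iota 0 m) + count (fun k => keep (m + k)) (iota 0 n).
Proof.
by rewrite iotaD count_cat [0 + m]addnC iotaDl count_map.
Qed.

Lemma eq_in_span keep keep' t : (forall k, k < nleaves t -> keep k = keep' k) ->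
  span keep t = span keep' t.
Proof.
elim/tree_ind': t keep keep' => [|a ts IH] keep keep' kk'; first by rewrite /= kk'.
rewrite !spanE; suff -> : spans keep ts = spans keep' ts by [].
elim: ts IH keep keep' kk' => //= t ts IHts IH keep keep' kk'; congr cons.
  by apply: IH => [|k kt]; rewrite ?mem_head // kk' // ltn_addr.
apply: IHts => [u uts|k kts]; first by apply: IH; rewrite inE uts orbT.
by apply: kk'; rewrite ltn_add2l.
Qed.

Lemma eq_spans keep keep' ts : keep =1 keep' -> spans keep ts = spans keep' ts.
Proof.
elim: ts keep keep' => //= t ts IH keep keep' kk'.
by rewrite (eq_in_span keep keep') // (IH _ (fun k => keep' (nleaves t + k))).
Qed.

Lemma span_nleaves keep t :
  if span keep t is Some u then
    nleaves u = count keep (iota 0 (nleaves t)) /\ 0 < nleaves u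
  else count keep (iota 0 (nleaves t)) = 0.
Proof.
elim/tree_ind': t keep => [|a ts IH] keep; first by rewrite /=; case: (keep 0).
rewrite spanE.
have: sumn (map nleaves (pmap id (spans keep ts))) =
      count keep (iota 0 (nleaves (Node a ts)))
   /\ all (fun u => 0 < nleaves u) (pmap id (spans keep ts)).
  rewrite /=; elim: ts IH keep => //= t ts IHts IH keep.
  have [|e p] := IHts _ (fun k => keep (nleaves t + k)).
    by move=> u uts; apply: IH; rewrite inE uts orbT.
  have := IH t (mem_head _ _) keep.
  rewrite count_iotaD -e; case: (span keep t) => [u [<- u0]|->] /=; last by split.
  by rewrite u0.
case: (pmap _ _) => [|u [|v us]] [<-] //=; first by rewrite addn0 andbT.
by case/andP=> u0 _; rewrite addn_gt0 u0.
Qed.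

(** A kept leaf [k] of [t] becomes leaf [count keep (iota 0 k)] of the spanned tree, since that many
    kept leaves precede it. *)
Lemma span_comp keep keep' t :
  obind (span keep') (span keep t) =
  span (fun k => keep k && keep' (count keep (iota 0 k))) t.
Proof.
elim/tree_ind': t keep keep' => [|a ts IH] keep keep'.
  by rewrite /=; case: (keep 0).
rewrite [in LHS]spanE [in RHS]spanE.
have <- : pmap id (spans keep' (pmap id (spans keep ts))) =
  pmap id (spans (fun k => keep k && keep' (count keep (iota 0 k))) ts).
  elim: ts IH keep keep' => //= t ts IHts IH keep keep'.
  rewrite -(IH t (mem_head _ _)).
  (* [c] is the number of leaves that the first input contributes to the intermediate tree, hence
     the offset at which the second span meets the remaining inputs. *)
  have := span_nleaves keep t; set c := count keep (iota 0 (nleaves t)) => cE.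
  rewrite [in RHS](eq_spans _ (fun k => keep (nleaves t + k) &&
      keep' (c + count (fun k => keep (nleaves t + k)) (iota 0 k)))); last first.
    by move=> k /=; rewrite count_iotaD.
  have {}IHts := IHts (fun u uts => IH u (mem_behead (uts : u \in behead (t :: ts)))).
  rewrite -(IHts _ (fun k => keep' (c + k))).
  clearbody c; case: (span keep t) cE => [u [<- _]|->] //=.
(* If one input survives the first span, its node is already suppressed; if several do, the node is
   still there and the second span decides as the combined one does. *)
case: (pmap id (spans keep ts)) => [|u [|v us]] //=.
by case: (span keep' u).
Qed.

Lemma span_tmap keep f t : span keep (tmap f t) = omap (tmap f) (span keep t).
Proof.
elim/tree_ind': t keep => [|a ts IH] keep; first by rewrite /=; case: (keep 0).
rewrite [LHS]spanE spanE.
have -> : pmap id (spans keep (map (tmap f) ts)) =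
          map (tmap f) (pmap id (spans keep ts)).
  elim: ts IH keep => //= t ts IHts IH keep.
  rewrite IH ?mem_head // nleaves_tmap IHts; last first.
    by move=> u uts; apply: IH; rewrite inE uts orbT.
  by case: (span keep t).
by case: (pmap id _) => [|u [|v us]].
Qed.

Lemma span_labels keep t u : span keep t = Some u -> {subset labels u <= labels t}.
Proof. by move/span_sub => [_ /mem_subseq]. Qed.

(** * Ranks of levels and monotone relabelling *)

Lemma ltn_rank_mono s : {in s &, {mono rank s : x y / x < y}}.
Proof.
move=> x y xs ys; case: (ltngtP x y) => [xy|yx|->]; last exact: ltnn.
  exact: ltn_rank.
by apply/negbTE; rewrite -leqNgt ltnW // ltn_rank.
Qed.

(** A rank counts distinct smaller values. Equality of values is the failure of both strict
    comparisons, so [undup] drops the same entries on both sides. *)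
Lemma rank_map (T : eqType) (u v : T -> nat) (s : seq T) x :
    {in x :: s &, forall y z, (v y < v z) = (u y < u z)} ->
  rank (map v s) (v x) = rank (map u s) (u x).
Proof.
rewrite /rank; elim: s => //= y s IH uv.
have uvE z : z \in s -> (v y == v z) = (u y == u z).
  move=> zs; have zs' : z \in [:: x, y & s] by rewrite !inE zs !orbT.
  have ys' : y \in [:: x, y & s] by rewrite !inE eqxx orbT.
  by have := uv y z ys' zs'; have := uv z y zs' ys'; lia.
have -> : (v y \in map v s) = (u y \in map u s).
  by apply/mapP/mapP => -[z zs /eqP e]; exists z => //; apply/eqP; rewrite ?uvE // -uvE.
have {}IH := IH (sub_in2 _ uv).
case: ifP => _ /=; rewrite ?(uv y x) ?inE ?eqxx ?orbT // IH //.
all: by move=> z; rewrite !inE => /orP[->|->] //; rewrite !orbT.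
Qed.

(** Without gaps, the values of [s] below [l] are exactly 0, ..., l - 1. *)
Lemma rank_initial_segment s l : initial_segment s -> l \in s -> rank s l = l.
Proof.
move=> /allP ss ls; rewrite -[RHS](size_iota 0) /rank -size_filter.
apply/perm_size/uniq_perm; rewrite ?filter_uniq ?undup_uniq ?iota_uniq // => m.
rewrite mem_filter mem_undup mem_iota add0n /=; case: (ltnP m l) => //= ml.
by have /allP/(_ m) := ss l ls; rewrite mem_iota; apply.
Qed.

(** Such relabellings do not change a weak order on nodes of color [c] with labels in [s].
    Monotonicity is confined to [s] because ranks are in general strictly monotone only on levels
    that occur. *)
Definition relevels (c : color) (f : label -> label) (s : seq label) : Prop :=
  [/\ forall a, (f a).1 = a.1, forall a, ~~ has_color c a -> f a = a
    & {in filter (has_color c) s &, forall a b, ((f a).2 < (f b).2) = (a.2 < b.2)}].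

Lemma sub_relevels c f s s' : {subset s' <= s} -> relevels c f s -> relevels c f s'.
Proof.
move=> ss [f1 fid fm]; split=> // a b; rewrite !mem_filter.
move=> /andP[ca /ss a_s] /andP[cb /ss b_s].
by rewrite fm // mem_filter ?ca ?cb.
Qed.

(** [renumber c t] unfolds to [tmap (rerank c (levels c t)) t]; with the list of levels as a
    parameter, the same relabelling can be applied to other trees. *)
Definition rerank c s (a : label) : label :=
  if has_color c a then (a.1, rank s a.2) else a.

Lemma relevels_rerank c t : relevels c (rerank c (levels c t)) (labels t).
Proof.
split=> [a|a /negPf ca|a b aF bF].
- by rewrite /rerank; case: ifP.
- by rewrite /rerank ca.
- have /andP[ca _] : has_color c a && (a \in labels t) by rewrite -mem_filter.
  have /andP[cb _] : has_color c b && (b \in labels t) by rewrite -mem_filter.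
  by rewrite /rerank ca cb ltn_rank_mono //; apply: map_f.
Qed.

Lemma levels_tmap c f t : (forall a, (f a).1 = a.1) ->
  levels c (tmap f t) = [seq (f a).2 | a <- labels t & has_color c a].
Proof.
move=> f1; rewrite /levels labels_tmap filter_map -map_comp; congr map.
by apply: eq_filter => a; rewrite /= /has_color f1.
Qed.

(** The new levels are ranks, and these depend only on the order of the old levels, which [f]
    preserves. *)
Lemma renumber_tmap c f t : relevels c f (labels t) ->
  renumber c (tmap f t) = renumber c t.
Proof.
case=> f1 fid fm; rewrite [LHS]tmap_comp; apply: eq_in_tmap => a at_ /=.
rewrite {1}/has_color f1 -/(has_color c a).
case: ifP => [ca|/negbT/fid//]; congr pair.
rewrite levels_tmap //; apply: (rank_map _ snd (fun a => (f a).2)).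
move=> b d; rewrite !inE => bF dF; apply: fm.
  by case/predU1P: bF => [->|//]; rewrite mem_filter ca.
by case/predU1P: dF => [->|//]; rewrite mem_filter ca.
Qed.

(** The recursion crosses painted nodes, which [f] fixes, and at each base leaf reduces to
    [renumber_tmap]. *)
Lemma renumber_base_leaves_tmap f t : relevels Unpainted f (labels t) ->
  renumber_base_leaves (tmap f t) = renumber_base_leaves t.
Proof.
elim/tree_ind': t => // -[c l] ts IH fr.
have [f1 fid _] := fr.
case: c IH fr => IH fr; last first.
- rewrite [LHS]/= [f _]surjective_pairing f1 /=.
  by have := renumber_tmap _ _ _ fr; rewrite /= [f _]surjective_pairing f1.
- rewrite [LHS]/= [f _]surjective_pairing f1 /=.
  by have := renumber_tmap _ _ _ fr; rewrite /= [f _]surjective_pairing f1.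
rewrite /= fid //; congr Node; rewrite -map_comp.
apply/eq_in_map => t tts; apply: IH => //; apply: sub_relevels fr => b bt.
by rewrite inE; apply/orP; right; apply/flatten_mapP; exists t.
Qed.

(** * Renumbering before and after spanning *)

Lemma span_renumber keep c t :
  omap (renumber c) (span keep (renumber c t)) = omap (renumber c) (span keep t).
Proof.
rewrite [in LHS]span_tmap; case tu: (span keep t) => [u|] //=; congr Some.
apply: renumber_tmap; apply: sub_relevels (relevels_rerank c t).
exact: span_labels tu.
Qed.

Lemma nleaves_renumber_base_leaves t : nleaves (renumber_base_leaves t) = nleaves t.
Proof.
elim/tree_ind': t => // -[[] l] ts IH; try exact: nleaves_tmap.
by rewrite /= -map_comp; congr sumn; apply/eq_in_map => t /IH.
Qed.

(** Each base leaf has its own relabelling, so in general no single [tmap] describes the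
    renumbering; the induction descends the painted base instead. *)
Lemma span_renumber_base_leaves keep t :
  omap renumber_base_leaves (span keep (renumber_base_leaves t)) =
  omap renumber_base_leaves (span keep t).
Proof.
elim/tree_ind': t keep => // -[c l] ts IH keep.
have spanU k u : omap renumber_base_leaves (span k (renumber Unpainted u)) =
                 omap renumber_base_leaves (span k u).
  rewrite [in LHS]span_tmap; case uv: (span k u) => [v|] //=; congr Some.
  apply: renumber_base_leaves_tmap; apply: sub_relevels (relevels_rerank _ u).
  exact: span_labels uv.
case: c => //; try exact: spanU.
rewrite [renumber_base_leaves _]/= !spanE.
have: map renumber_base_leaves
    (pmap id (spans keep (map renumber_base_leaves ts))) =
  map renumber_base_leaves (pmap id (spans keep ts)).
  elim: ts IH keep => //= t ts IHts IH keep.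
  have {}IHts := IHts (fun u uts => IH u (mem_behead (uts : u \in behead (t :: ts)))).
  have := IH t (mem_head _ _) keep; rewrite nleaves_renumber_base_leaves.
  case: (span keep t) => [u|]; case: (span keep _) => [u1|] //=.
  by case=> ->; rewrite IHts.
case: (pmap id (spans keep ts)) => [|u [|v us]]; case: (pmap id _) => [|u' [|v' us']] //=.
  by case=> ->.
by case=> -> -> ->.
Qed.

(** * Normalised trees and the two commuting renumberings *)

Lemma levels_forget c t : levels c (forget c t) = levels c t.
Proof.
rewrite levels_tmap => [|a]; last by case: ifP.
by apply/eq_in_map => a; rewrite mem_filter => /andP[->].
Qed.

Lemma renumber_id c t : initial_segment (levels c t) -> renumber c t = t.
Proof.
move=> ct; apply: tmap_in_id => -[d l] at_ /=; case: ifP => // ca.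
congr pair; apply: rank_initial_segment => //.
by apply/mapP; exists (d, l); rewrite ?mem_filter ?ca.
Qed.

Lemma renumber_base_leaves_id t :
  all (weakly_ordered Unpainted) (base_leaves t) -> renumber_base_leaves t = t.
Proof.
elim/tree_ind': t => // -[[] l] ts IH; last 2 first.
- by rewrite /= andbT => /andP[st _]; apply: renumber_id.
- by rewrite /= andbT => /andP[st _]; apply: renumber_id.
move=> /allP ots; rewrite /=; congr Node; rewrite -[RHS]map_id.
apply/eq_in_map => t tts; apply: IH => //; apply/allP => u ut; apply: ots.
by apply/flatten_mapP; exists t.
Qed.

(** [f] alters only labels of other colors, so it changes neither the levels of color [c] nor the
    nodes that are renumbered. *)
Lemma renumber_tmapC c f t : (forall a, (f a).1 = a.1) ->
    (forall a, has_color c a -> f a = a) ->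
  renumber c (tmap f t) = tmap f (renumber c t).
Proof.
move=> f1 fid; rewrite [LHS]tmap_comp [RHS]tmap_comp; apply: eq_tmap => a /=.
rewrite {1}/has_color f1 -/(has_color c a) levels_tmap //.
case: ifP => // ca; rewrite [in RHS]fid // fid //; congr (_, rank _ _).
by apply/eq_in_map => b; rewrite mem_filter => /andP[/fid->].
Qed.

Lemma renumber_base_leaves_tmapC f t : (forall a, (f a).1 = a.1) ->
    (forall a, ~~ has_color Painted a -> f a = a) ->
  renumber_base_leaves (tmap f t) = tmap f (renumber_base_leaves t).
Proof.
move=> f1 fid; have fU a : has_color Unpainted a -> f a = a.
  by move=> /eqP ca; apply: fid; rewrite /has_color ca.
elim/tree_ind': t => // -[[] l] ts IH; last 2 first.
- by have := renumber_tmapC _ f (Node (Half, l) ts) f1 fU; rewrite /= fid.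
- by have := renumber_tmapC _ f (Node (Unpainted, l) ts) f1 fU; rewrite /= fid.
rewrite /= [f _]surjective_pairing f1 /= -!map_comp; congr Node.
by apply/eq_in_map => t /IH.
Qed.

(** Together with [forest_norm], this separates the action of [restrict_orders] on painted levels
    from that on unpainted ones. *)
Definition base_norm D t := if D is BaseWeakTrees then renumber Painted t else t.

Definition forest_norm C t :=
  match C with
  | ForestWeakTrees => renumber_base_leaves t
  | WeakForest => renumber Unpainted t
  | _ => t
  end.

Lemma restrict_ordersE C D t :
  restrict_orders C D t = forest_norm C (base_norm D t).
Proof. by case: C; case: D. Qed.

Lemma levels_forest_norm C t : levels Painted (forest_norm C t) = levels Painted t.
Proof.
rewrite -[LHS]levels_forget -[RHS]levels_forget; congr levels.
case: C => //=; first exact: forget_renumber_base_leaves.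
exact: forget_renumber.
Qed.

(** The painted ranks are computed from painted levels, which the forest renumbering leaves alone,
    and the two relabellings act on different colors. *)
Lemma base_forest_normC C D t :
  base_norm D (forest_norm C t) = forest_norm C (base_norm D t).
Proof.
case: D => //=.
have renumberE u : renumber Painted u = tmap (rerank Painted (levels Painted u)) u by [].
rewrite !renumberE levels_forest_norm; set f := rerank _ _.
have f1 a : (f a).1 = a.1 by rewrite /f /rerank; case: ifP.
case: C => //=.
  by rewrite renumber_base_leaves_tmapC // => a /negPf; rewrite /f /rerank => ->.
by rewrite renumber_tmapC // => a /eqP; rewrite /f /rerank /has_color => ->.
Qed.

Lemma span_forest_norm C keep t :
  omap (forest_norm C) (span keep (forest_norm C t)) =
  omap (forest_norm C) (span keep t).
Proof.
case: C => //=; first exact: span_renumber_base_leaves.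
exact: span_renumber.
Qed.

Lemma span_base_norm D keep t :
  omap (base_norm D) (span keep (base_norm D t)) =
  omap (base_norm D) (span keep t).
Proof. by case: D => //=; exact: span_renumber. Qed.

Lemma span_restrict_orders C D keep t :
  omap (restrict_orders C D) (span keep (restrict_orders C D t)) =
  omap (restrict_orders C D) (span keep t).
Proof.
(* The two renumberings commute, so either can be applied last. *)
have e u : omap (restrict_orders C D) u = omap (base_norm D) (omap (forest_norm C) u).
  by case: u => //= u; rewrite restrict_ordersE base_forest_normC.
have e' u : omap (restrict_orders C D) u = omap (forest_norm C) (omap (base_norm D) u).
  by case: u => //= u; rewrite restrict_ordersE.
by rewrite restrict_ordersE e span_forest_norm -e e' span_base_norm -e'.
Qed.

Lemma restrict_orders_id C D t : is_painted_tree C D t -> restrict_orders C D t = t.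
Proof.
case/and5P => _ _ _ bt ft; rewrite restrict_ordersE.
have -> : base_norm D t = t by case: D bt => //= /andP[st _]; apply: renumber_id.
case: C ft => //= [|/andP[st _]]; first exact: renumber_base_leaves_id.
exact: renumber_id.
Qed.

Lemma nleaves_restrict_orders C D t : nleaves (restrict_orders C D t) = nleaves t.
Proof.
rewrite restrict_ordersE; transitivity (nleaves (base_norm D t)).
  case: C => //=; first exact: nleaves_renumber_base_leaves.
  exact: nleaves_tmap.
by case: D => //; apply: nleaves_tmap.
Qed.

(** * Restriction to an interval of leaves *)

Lemma count_itv_iota i j n :
  count (fun k => i <= k <= j) (iota 0 n) = minn n j.+1 - i.
Proof.
elim: n => [|n IH]; first by rewrite min0n.
rewrite -addn1 iotaD count_cat IH /= add0n addn0.
by case: (leqP i n) => ?; case: (leqP n j) => ? /=; lia.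
Qed.

(** Such an interval keeps at least one leaf, so the default [Leaf] of [restrict_tree] does not
    arise. *)
Lemma span_itv i j t : i <= j < nleaves t ->
  exists2 u, span (fun k => i <= k <= j) t = Some u & nleaves u = (j - i).+1.
Proof.
move=> ijt; have := span_nleaves (fun k => i <= k <= j) t.
rewrite count_itv_iota; case: (span _ t) => [u [uE _]|]; last by lia.
by exists u => //; lia.
Qed.

Section Restrict.
Variables (C : forest_type) (D : base_type).
Implicit Types w : painted_tree C D.

Lemma nleaves_degree w : nleaves w = (degree w).+1.
Proof.
by case: w => t /= /and5P[/plane_nleaves_gt0 t0 _ _ _ _]; rewrite /degree prednK.
Qed.

Lemma degree_restrict w i j : i <= j <= degree w -> degree (restrict w i j) = j - i.
Proof.
rewrite -(ltnS j) -nleaves_degree => /span_itv [u su uE].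
by rewrite /degree /= /restrict_tree su nleaves_restrict_orders uE.
Qed.

(** Every node contributes at least two leaves. This identifies the piece of degree 0 in the end
    terms of the coproduct, on which the counit is 1. *)
Lemma degree0 w : degree w = 0 -> w = one_leaf C D.
Proof.
move=> w0; apply: val_inj; apply: plane_nleaves1; last by rewrite nleaves_degree w0.
by case: (w) => t /= /and5P[].
Qed.

Lemma restrict_full w : restrict w 0 (degree w) = w.
Proof.
apply: val_inj; rewrite /= /restrict_tree (eq_in_span _ predT); last first.
  by move=> k; rewrite nleaves_degree.
rewrite (_ : span predT w = Some (w : tree)) ?restrict_orders_id ?(valP w) //=.
have: plane w by case: (w) => t /= /and5P[].
elim/tree_ind': (w : tree) => //= a ts IH /andP[ts1 pts].
(* Every input survives, and a plane node has at least two, so no node is suppressed. *)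
suff -> : pmap id (spans predT ts) = ts by case: ts ts1 {IH pts} => [|t [|]].
elim: ts IH pts {ts1} => //= t ts IHts IH /andP[pt pts].
rewrite (eq_spans _ predT) // IH ?mem_head //= IHts // => u uts.
by apply: IH; rewrite inE uts orbT.
Qed.

Lemma restrict_restrict w a b c d : a <= b <= degree w -> c <= d <= b - a ->
  restrict (restrict w a b) c d = restrict w (a + c) (a + d).
Proof.
move=> abw cdb; apply: val_inj; rewrite /= /restrict_tree.
have [|u su uE] := span_itv a b w; first by rewrite nleaves_degree.
have [|v sv _] := span_itv c d u; first by rewrite uE.
(* The second renumbering erases the first, so the orders can be restricted once, at the end. *)
have := span_restrict_orders C D (fun k => c <= k <= d) u.
rewrite su sv /=; have [|v' -> _ [->]] := span_itv c d (restrict_orders C D u).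
  by rewrite nleaves_restrict_orders uE.
have := span_comp (fun k => a <= k <= b) (fun k => c <= k <= d) w.
rewrite su /= sv => sw; rewrite (eq_in_span _ (fun k => (a <= k <= b) &&
   (c <= count (fun l => a <= l <= b) (iota 0 k) <= d))) -?sw // => k _.
(* For [a <= k <= b], exactly [k - a] leaves of the interval precede leaf [k], so the test becomes
   [a + c <= k <= a + d]. *)
rewrite count_itv_iota; lia.
Qed.

End Restrict.

(** * Double sums and linear extensions *)

Local Open Scope ring_scope.

Lemma exchange_big_triangle (V : nmodType) n (G : nat -> nat -> V) :
  \sum_(0 <= i < n) \sum_(0 <= k < i.+1) G k i =
  \sum_(0 <= k < n) \sum_(k <= i < n) G k i.
Proof.
elim: n => [|n IH]; first by rewrite !big_geq.
rewrite big_nat_recr //= {}IH [RHS]big_nat_recr //= big_nat1 big_nat_recr //=.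
rewrite addrA -big_split /=; congr (_ + _); apply: eq_big_nat => k /andP[_ kn].
by rewrite big_nat_recr // ltnW.
Qed.

Section LinExt.
Variables (K : fieldType).

Lemma lin_ext_id (T : choiceType) (u : {malg K[T]}) : lin_ext (fun x => << x >>) u = u.
Proof. by rewrite -(lin_ext_unique idfun). Qed.

(** This reduces gradedness to basis elements: a coefficient of [lin_ext f u] vanishes once it
    vanishes in [f x] for every [x] in the support of [u]. *)
Lemma msupp_lin_ext (S T : choiceType) (f : S -> {malg K[T]}) u y :
  y \in msupp (lin_ext f u) -> exists2 x, x \in msupp u & y \in msupp (f x).
Proof.
rewrite -mcoeff_neq0 => yu.
have /hasP[x xu yx] : has (fun x => y \in msupp (f x)) (msupp u).
  apply: contraR yu => /hasPn yn; rewrite raddf_sum big1_seq // => x /andP[_ /yn].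
  by rewrite /= mcoeffZ => /mcoeff_outdom ->; rewrite mulr0.
by exists x.
Qed.

End LinExt.

(** * The splitting coproduct on basis elements *)

Section Splitting.
Variables (K : fieldType) (C : forest_type) (D : base_type).
Local Notation P := (painted_tree C D).
Implicit Types w : P.

Definition splitting w : {malg K[(P * P)%type]} :=
  \sum_(0 <= i < (degree w).+1) << (restrict w 0 i, restrict w i (degree w)) >>.

Lemma splitting_coassoc w :
  \sum_(0 <= i < (degree w).+1)
     tens_assoc (tens (splitting (restrict w 0 i)) << restrict w i (degree w) >>) =
  \sum_(0 <= i < (degree w).+1)
     tens << restrict w 0 i >> (splitting (restrict w i (degree w))).
Proof.
(* [G k i] cuts [w] at the leaves [k] and [i]; the two sides group these terms by whichever cut is
   made first. *)
pose G k i : {malg K[(P * (P * P))%type]} :=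
  << (restrict w 0 k, (restrict w k i, restrict w i (degree w))) >>.
transitivity (\sum_(0 <= i < (degree w).+1) \sum_(0 <= k < i.+1) G k i).
  apply: eq_big_nat => i iw; have {}iw : (0 <= i <= degree w)%N by lia.
  rewrite /splitting degree_restrict // subn0 /tens linear_sum /tens_assoc linear_sum.
  apply: eq_big_nat => k ki; rewrite /= lin_ext_basis /= !lin_ext_basis /= /G.
  by rewrite !restrict_restrict ?add0n ?subn0 //; lia.
transitivity (\sum_(0 <= k < (degree w).+1) \sum_(k <= i < (degree w).+1) G k i).
  exact: exchange_big_triangle.
apply: eq_big_nat => k kw; have {}kw : (k <= degree w <= degree w)%N by lia.
rewrite /splitting degree_restrict // /tens lin_ext_basis linear_sum -subSn; last by lia.
(* Leaf [i] of the right-hand piece is leaf [i + k] of [w], hence the shift of the range. *)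
rewrite -{1}[k]add0n big_addn; apply: eq_big_nat => i ik.
have di : (0 <= i <= degree w - k)%N by lia.
have di' : (i <= degree w - k <= degree w - k)%N by lia.
rewrite /= lin_ext_basis (restrict_restrict _ _ _ _ _ _ _ kw di).
rewrite (restrict_restrict _ _ _ _ _ _ _ kw di') addn0 (addnC k) subnKC //.
by case/andP: kw.
Qed.

End Splitting.

(** * Assembly of the graded coalgebra structure *)

Theorem theorem3p1 (K : fieldType) (charK0 : [pchar K] =i pred0)
    (C : forest_type) (D : base_type) :
  exists Delta : {linear {malg K[painted_tree C D]} ->
                         {malg K[(painted_tree C D * painted_tree C D)%type]}},
    (forall w : painted_tree C D,
       Delta << w >> = \sum_(i < (degree w).+1)
         tens << restrict w 0 i >> << restrict w i (degree w) >>)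
    /\ graded_coalgebra (fun w : painted_tree C D => degree w)
         Delta (mcoeff (one_leaf C D)).
Proof.
exists (lin_ext (splitting K C D)).
split=> [w|].
  rewrite /= lin_ext_basis /splitting big_mkord; apply: eq_bigr => i _.
  by rewrite tens_basis.
split=> [||u|u|u|d u ud [x y]|d u ud d0].
- exact: linearP.
- by move=> a u v; rewrite mcoeffD mcoeffZ.
- rewrite /tens_assoc /tens_map !lin_ext_comp; apply: eq_lin_ext => w.
  (* Only the outer coproduct on each side is unfolded; the inner one stays a map applied to one
     tensor factor. *)
  rewrite /= {2 4}/splitting !linear_sum /=.
  transitivity (\sum_(0 <= i < (degree w).+1)
     tens_assoc (tens (splitting K C D (restrict w 0 i)) << restrict w i (degree w) >>)).
    by apply: eq_bigr => i _; rewrite lin_ext_basis /= lin_ext_basis.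
  rewrite splitting_coassoc; apply: eq_bigr => i _.
  by rewrite lin_ext_basis /= lin_ext_basis.
- rewrite /form_tensl lin_ext_comp -[RHS]lin_ext_id; apply: eq_lin_ext => w.
  (* Only the cut at leaf 0 has a first piece of degree 0, and its second piece is all of [w]. *)
  rewrite /= /splitting linear_sum big_nat_recl // big_nat big1 => [|i iw] /=.
    rewrite lin_ext_basis /= restrict_full (degree0 _ _ (restrict w 0 0)).
      by rewrite mcoeffUU scale1r addr0.
    by rewrite degree_restrict.
  rewrite lin_ext_basis /= mcoeffU; case: eqP => [e|_]; last by rewrite scale0r.
  have: degree (restrict w 0 i.+1) = 0%N by rewrite e.
  by rewrite degree_restrict.
- rewrite /form_tensr lin_ext_comp -[RHS]lin_ext_id; apply: eq_lin_ext => w.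
  (* Symmetrically, only the cut at the last leaf survives. *)
  rewrite /= /splitting linear_sum big_nat_recr //= big_nat big1 => [|i iw] /=.
    rewrite lin_ext_basis /= restrict_full.
    rewrite (degree0 _ _ (restrict w (degree w) (degree w))).
      by rewrite mcoeffUU scale1r add0r.
    by rewrite degree_restrict ?subnn ?leqnn.
  rewrite lin_ext_basis /= mcoeffU; case: eqP => [e|_]; last by rewrite scale0r.
  have: degree (restrict w i (degree w)) = 0%N by rewrite e.
  by rewrite degree_restrict; lia.
(* The pieces of a cut at leaf [i] have degrees [i] and [degree w - i]. *)
- case/msupp_lin_ext => w /ud <- /=; rewrite -mcoeff_neq0 raddf_sum.
  apply: contraNeq => xy; apply/eqP; apply: big1_seq => i /andP[_].
  rewrite mem_index_iota => iw; rewrite /= mcoeffU; case: eqP => // -[ex ey].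
  by case/eqP: xy; rewrite -ex -ey !degree_restrict; lia.
- apply: mcoeff_outdom; apply: contra d0 => /ud <-.
  by [].
Qed.
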